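(* (i) Let $J:\mathfrak{u}(2)\to\mathfrak{u}(2)$ be an $\mathbb{R}$-linear map, identified with its matrix in the basis $(J_1,J_2,J_3,J_4)$. Then $J$ has zero torsion if and only if there exist $\Phi\in SO(3)\times\mathbb{R}_+^*$ and $\begin{pmatrix}\xi^3_3&\xi^3_4\\ \xi^4_3&\xi^4_4\end{pmatrix}\in \mathfrak{gl}(2,\mathbb{R})$ (an arbitrary real $2\times2$ matrix) such that $$\Phi^{-1}J\Phi=\begin{pmatrix}0&1&0&0\\-1&0&0&0\\0&0&\xi^3_3&\xi^3_4\\0&0&\xi^4_3&\xi^4_4\end{pmatrix}.$$ (ii) Every complex structure $J$ on $\mathfrak{u}(2)$ is equivalent to a unique $$J(\xi)=\begin{pmatrix}0&1&0&0\\-1&0&0&0\\0&0&\xi&1\\0&0&-(1+\xi^2)&-\xi\end{pmatrix}$$ with $\xi\in\mathbb{R}$. For $\xi,\xi'\in\mathbb{R}$, $J(\xi)$ and $J(\xi')$ are equivalent if and only if $\xi=\xi'$.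
   Context: $\mathfrak{u}(2)=\mathfrak{su}(2)\oplus\mathbb{R}J_4$ is the real Lie algebra with basis $(J_1,J_2,J_3,J_4)$, where $[J_1,J_2]=J_3$, $[J_2,J_3]=J_1$, $[J_3,J_1]=J_2$ and $J_4$ is central. Linear maps are identified with their matrices in this basis (columns are images of basis vectors). $SO(3)\times\mathbb{R}_+^*$ denotes the group of block-diagonal matrices $\mathrm{diag}(A,b)$ with $A\in SO(3)$ acting on $\mathrm{span}(J_1,J_2,J_3)$ and $b>0$ acting on $\mathbb{R}J_4$. A linear map $J:\mathfrak{g}\to\mathfrak{g}$ on a real Lie algebra has zero torsion if $[JX,JY]-[X,Y]-J[JX,Y]-J[X,JY]=0$ for all $X,Y\in\mathfrak{g}$. A complex structure on $\mathfrak{g}$ is a linear map $J:\mathfrak{g}\to\mathfrak{g}$ with $J^2=-1$ and zero torsion. Two complex structures $J,J'$ on $\mathfrak{g}$ are equivalent if $J'=\Phi J\Phi^{-1}$ for some Lie algebra automorphism $\Phi$ of $\mathfrak{g}$. *)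

(* Defs.v *)
From HB Require Import structures.
From mathcomp Require Import all_boot all_order all_algebra.
From mathcomp Require Import reals.
From mathcomp Require Import ring.

Set Implicit Arguments.
Unset Strict Implicit.
Unset Printing Implicit Defensive.

Import Order.TTheory GRing.Theory Num.Theory.
Local Open Scope ring_scope.

HB.mixin Record isLieAlgebra (R : realType) V of Vector R V := {
  lie : V -> V -> V;
  lie_linearl : forall (a : R) (x y z : V),
    lie (a *: x + y) z = a *: lie x z + lie y z;
  lie_linearr : forall (a : R) (x y z : V),
    lie z (a *: x + y) = a *: lie z x + lie z y;
  liexx : forall x : V, lie x x = 0;
  lie_jacobi : forall x y z : V,
    lie x (lie y z) + lie y (lie z x) + lie z (lie x y) = 0
}.

#[short(type="lieAlgType")]
HB.structure Definition LieAlgebra (R : realType) :=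
  { V of Vector R V & isLieAlgebra R V }.

Definition zero_torsion (R : realType) (g : lieAlgType R) (J : 'End(g)) : Prop :=
  forall X Y : g,
    lie (J X) (J Y) - lie X Y - J (lie (J X) Y) - J (lie X (J Y)) = 0.

Definition complex_structure (R : realType) (g : lieAlgType R) (J : 'End(g)) :
    Prop :=
  (J \o J)%VF = - \1%VF /\ zero_torsion J.

Definition lie_automorphism (R : realType) (g : lieAlgType R) (Phi : 'End(g)) :
    Prop :=
  bijective Phi /\ forall X Y : g, Phi (lie X Y) = lie (Phi X) (Phi Y).

(* A relation between complex structures: being one is part of it. Since Phi is
   bijective, (Phi^-1)%VF is its two-sided inverse. *)
Definition equivalent (R : realType) (g : lieAlgType R) (J J' : 'End(g)) :
    Prop :=
  [/\ complex_structure J, complex_structure J' &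
      exists Phi : 'End(g),
        lie_automorphism Phi /\ J' = (Phi \o J \o Phi^-1)%VF].

(* The coordinates are those in the basis (J_1, J_2, J_3, J_4), numbered from
   0, so that u2_basis i is J_(i+1). *)
Definition u2 (R : realType) := 'cV[R]_4.

HB.instance Definition _ (R : realType) := Vector.on (u2 R).

Definition u2_basis (R : realType) (i : 'I_4) : u2 R := delta_mx i 0.

Definition u2_lie (R : realType) (x y : u2 R) : u2 R :=
  \col_(i < 4) [:: x 1 0 * y 2 0 - x 2 0 * y 1 0;
                   x 2 0 * y 0 0 - x 0 0 * y 2 0;
                   x 0 0 * y 1 0 - x 1 0 * y 0 0;
                   0]`_i.

Section U2LieAlgebra.
Variable R : realType.

Let ord4P (P : 'I_4 -> Prop) : P 0 -> P 1 -> P 2 -> P 3 -> forall i, P i.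
Proof.
move=> P0 P1 P2 P3 [[|[|[|[|//]]]] lti];
  [move: P0 | move: P1 | move: P2 | move: P3];
  by congr P; apply: val_inj.
Qed.

Let u2P (x y : u2 R) :
  x 0 0 = y 0 0 -> x 1 0 = y 1 0 -> x 2 0 = y 2 0 -> x 3 0 = y 3 0 -> x = y.
Proof. by move=> *; apply/colP; apply: ord4P. Qed.

Fact u2_lie_linearl (a : R) (x y z : u2 R) :
  u2_lie (a *: x + y) z = a *: u2_lie x z + u2_lie y z.
Proof. by apply: u2P; rewrite !mxE /=; ring. Qed.

Fact u2_lie_linearr (a : R) (x y z : u2 R) :
  u2_lie z (a *: x + y) = a *: u2_lie z x + u2_lie z y.
Proof. by apply: u2P; rewrite !mxE /=; ring. Qed.

Fact u2_liexx (x : u2 R) : u2_lie x x = 0.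
Proof. by apply: u2P; rewrite !mxE /=; ring. Qed.

Fact u2_lie_jacobi (x y z : u2 R) :
  u2_lie x (u2_lie y z) + u2_lie y (u2_lie z x) + u2_lie z (u2_lie x y) = 0.
Proof. by apply: u2P; rewrite !mxE /=; ring. Qed.

HB.instance Definition _ := isLieAlgebra.Build R (u2 R)
  u2_lie_linearl u2_lie_linearr u2_liexx u2_lie_jacobi.

Local Notation J1 := (u2_basis R 0).
Local Notation J2 := (u2_basis R 1).
Local Notation J3 := (u2_basis R 2).
Local Notation J4 := (u2_basis R 3).

Lemma u2_lie12 : lie J1 J2 = J3.
Proof. by apply: u2P; rewrite !mxE /=; ring. Qed.

Lemma u2_lie23 : lie J2 J3 = J1.
Proof. by apply: u2P; rewrite !mxE /=; ring. Qed.

Lemma u2_lie31 : lie J3 J1 = J2.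
Proof. by apply: u2P; rewrite !mxE /=; ring. Qed.

Lemma u2_lie4 (x : u2 R) : lie J4 x = 0.
Proof. by apply: u2P; rewrite !mxE /=; ring. Qed.

End U2LieAlgebra.

(* Columns are the images of the basis vectors. *)
Definition u2_mx (R : realType) (J : 'End(u2 R)) : 'M[R]_4 :=
  \matrix_(i, j) J (u2_basis R j) i 0.

Definition u2_end (R : realType) (M : 'M[R]_4) : 'End(u2 R) :=
  linfun (mulmx M : 'cV[R]_4 -> 'cV[R]_4).

Lemma u2_endE (R : realType) (M : 'M[R]_4) (x : u2 R) : u2_end M x = M *m x.
Proof. by rewrite lfunE. Qed.

Lemma u2_endK (R : realType) : cancel (@u2_end R) (@u2_mx R).
Proof.
by move=> M; apply/matrixP => i j; rewrite !mxE u2_endE -colE mxE.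
Qed.

Lemma u2_mxK (R : realType) : cancel (@u2_mx R) (@u2_end R).
Proof.
move=> J; apply/lfunP => x; rewrite u2_endE.
have -> : x = \sum_j x j 0 *: u2_basis R j.
  by rewrite [LHS]matrix_sum_delta; apply: eq_bigr => j _; rewrite big_ord1.
rewrite mulmx_sumr [RHS]linear_sum; apply: eq_bigr => j _.
rewrite -scalemxAr [RHS]linearZ -colE; congr (_ *: _).
by apply/colP => i; rewrite !mxE.
Qed.

Definition SO3 (R : realType) (A : 'M[R]_3) : Prop :=
  A *m A^T = 1%:M /\ \det A = 1.

Definition SO3xRpos (R : realType) (Phi : 'M[R]_4) : Prop :=
  exists (A : 'M[R]_3) (b : R),
    [/\ SO3 A, 0 < b & Phi = block_mx A 0 0 (b%:M : 'M_1) :> 'M_(3 + 1)].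

Definition mx2 (R : realType) (a b c d : R) : 'M[R]_2 :=
  \matrix_(i, j) (nth [::] [:: [:: a; b]; [:: c; d]] i)`_j.

Definition u2_normal_form (R : realType) (xi : 'M[R]_2) : 'M[R]_4 :=
  block_mx (mx2 0 1 (- 1) 0) 0 0 xi : 'M[R]_(2 + 2).

Definition u2_J (R : realType) (xi : R) : 'End(u2 R) :=
  u2_end (u2_normal_form (mx2 xi 1 (- (1 + xi ^+ 2)) (- xi))).

(* Main.v *)
Require Import Defs.
From mathcomp Require Import all_boot all_order all_algebra.
From mathcomp Require Import reals.
From mathcomp Require Import ring lra.

Import Order.TTheory GRing.Theory Num.Theory.
Local Open Scope ring_scope.

(* Write J = [[N, u], [w^T, d]] with N acting on the derived algebra R^3, whose
   bracket is the cross product. As N x * N y = cof(N) (x * y) and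
   N x * y + x * N y = (tr N - N^T) (x * y), the vanishing of the torsion on R^3
   becomes, by Cayley-Hamilton, (N + N^T) (N^T - tr N) = 1 - s, where s is the
   sum of the principal 2-minors of N. With S = N + N^T and K = N - N^T this
   makes S K symmetric and commuting with S, whence S K = 0. Were K = 0, the
   cofactor matrix of N would be -1, which is impossible; so S is a multiple of
   n n^T, where n spans the kernel of K, and the remaining equation forces n to
   be a unit vector with N = t n n^T - n * _. The torsion on pairs
   (X, J_4), resp. its last coordinate, makes u, resp. w, a multiple of n, so a
   rotation taking e_3 to n yields the normal form. *)

(** * Index cases and sums in dimensions 3 and 4 *)

Lemma ord3_ind (P : 'I_3 -> Prop) : P 0 -> P 1 -> P 2 -> forall i, P i.
Proof.
move=> P0 P1 P2 [[|[|[|//]]] lti]; [move: P0 | move: P1 | move: P2];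
  by congr P; apply: val_inj.
Qed.

Lemma ord4_ind (P : 'I_4 -> Prop) : P 0 -> P 1 -> P 2 -> P 3 -> forall i, P i.
Proof.
move=> P0 P1 P2 P3 [[|[|[|[|//]]]] lti];
  [move: P0 | move: P1 | move: P2 | move: P3];
  by congr P; apply: val_inj.
Qed.

Lemma sum_ord3 (V : nmodType) (F : 'I_3 -> V) :
  \sum_i F i = F 0 + F 1 + F 2.
Proof.
rewrite !big_ord_recl big_ord0 addr0 addrA.
by congr (_ + F _ + F _); apply: val_inj.
Qed.

Lemma sum_ord4 (V : nmodType) (F : 'I_4 -> V) :
  \sum_i F i = F 0 + F 1 + F 2 + F 3.
Proof.
rewrite !big_ord_recl big_ord0 addr0 !addrA.
by congr (_ + F _ + F _ + F _); apply: val_inj.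
Qed.

(** * Products of symmetric and skew-symmetric matrices *)

(** The diagonal entries of [A^T *m A] are the sums of squares of the columns of [A]. *)
Lemma mulmx_tr_eq0 (R : realDomainType) (m n : nat) (A : 'M[R]_(m, n)) :
  A^T *m A = 0 -> A = 0.
Proof.
move=> A0; apply/matrixP => i j; rewrite mxE.
have /eqP := congr1 (fun B : 'M_n => B j j) A0; rewrite /= !mxE.
rewrite psumr_eq0 => [/allP /(_ i)|k _]; rewrite !mxE -expr2 ?sqr_ge0 //.
by rewrite mem_index_enum sqrf_eq0 => /(_ isT) /eqP.
Qed.

(* SK = -KS is symmetric and commutes with S, so S(SK) = (SK)S = -S(SK); hence
   S(SK) = 0 and |SK|^2 = -K S (SK) = 0. *)
Lemma mul_sym_skew_eq0 (R : realFieldType) (n : nat) (S K : 'M[R]_n) :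
  S^T = S -> K^T = - K -> (S *m K)^T = S *m K ->
  S *m (S *m K) = S *m K *m S -> S *m K = 0.
Proof.
move=> Ssym Kskew SKsym SKcomm.
have SK : S *m K = - (K *m S) by rewrite -SKsym trmx_mul Ssym Kskew mulNmx.
have SSK : S *m (S *m K) = 0.
  apply/matrixP => i j; rewrite [RHS]mxE; have := SKcomm.
  have -> : S *m K *m S = - (S *m (S *m K)).
    by rewrite -mulmxA -mulmxN SK opprK.
  by move=> /matrixP /(_ i j); rewrite [in RHS]mxE; lra.
by apply: mulmx_tr_eq0; rewrite SKsym {1}SK mulNmx -mulmxA SSK mulmx0 oppr0.
Qed.

(** * Matrices with explicit entries *)

(** After [mxE], entries compute by [/=], which leaves polynomial identities to [ring] and [lra]. *)
Definition mx_of_rows {R : nmodType} {m n : nat} (rows : seq (seq R)) :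
  'M[R]_(m, n) := \matrix_(i, j) (nth [::] rows i)`_j.

Lemma det_mx3 (R : comRingType) (A : 'M[R]_3) :
  \det A = A 0 0 * (A 1 1 * A 2 2 - A 1 2 * A 2 1)
         - A 0 1 * (A 1 0 * A 2 2 - A 1 2 * A 2 0)
         + A 0 2 * (A 1 0 * A 2 1 - A 1 1 * A 2 0).
Proof.
(* Indexing by naturals lets the index shifts of the expansion reduce to numerals. *)
pose B (i j : nat) := A (inord i) (inord j).
have AE i j : A i j = B i j by rewrite /B !inord_val.
rewrite (expand_det_row _ 0) sum_ord3 /cofactor.
rewrite !(expand_det_row _ 0) !big_ord_recl !big_ord0 /cofactor !det_mx11.
rewrite !mxE !AE /= /bump /=.
ring.
Qed.

(** * The torsion equation on the derived algebra *)

(** The symmetric matrix with rows (a, f, e), (f, b, d), (e, d, c) is assumed to have cofactor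
    matrix -1. Its off-diagonal entries then vanish, so ab = ac = bc = -1 and 1 = (ab)(ac) =
    -a^2. *)
Lemma cofactor_sym3_neqN1 (R : realFieldType) (a b c d e f : R) :
  b * c - d ^+ 2 = -1 -> a * c - e ^+ 2 = -1 -> a * b - f ^+ 2 = - 1 ->
  f * c = e * d -> f * d = e * b -> f * e = a * d -> False.
Proof.
move=> h1 h2 h3 h4 h5 h6.
have mul z (x y : R) : x = y -> z * x = z * y by move=> ->.
have f0 : f = 0.
  move: (mul a _ _ h4) (mul f _ _ h2) (mul e _ _ h6).
  lra.
have e0 : e = 0.
  move: (mul a _ _ h5) (mul f _ _ h6) (mul e _ _ h3).
  lra.
have d0 : d = 0.
  move: (mul f _ _ h5) (mul d _ _ h3) (mul b _ _ h6).
  lra.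
move: h1 h2 h3; rewrite d0 e0 f0 => h1 h2 h3.
have := sqr_ge0 a.
move: (mul (a * b) _ _ h2) (mul (a ^+ 2) _ _ h1) h3; lra.
Qed.

(** Here [a], ..., [f] are the entries of S / 2, n = (p, q, r) is such that K / 2 is the cross
    product with -n, and [s] is the sum of the principal 2-minors of N. The first three hypotheses
    say that the rows of S are parallel to n, that is, S K = 0; the last two are the quadratic
    equation left for S. *)
Lemma sym3_rank_one (R : realFieldType) (a b c d e f p q r : R) :
  let t := a + b + c in
  let s := (a * b - f ^+ 2) + (a * c - e ^+ 2) + (b * c - d ^+ 2)
           + (p ^+ 2 + q ^+ 2 + r ^+ 2) in
  [/\ a * q = f * p, a * r = e * p & f * r = e * q] ->
  [/\ f * q = b * p, f * r = d * p & b * r = d * q] ->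
  [/\ e * q = d * p, e * r = c * p & d * r = c * q] ->
  [/\ a ^+ 2 + f ^+ 2 + e ^+ 2 - t * a = (1 - s) / 2,
      f ^+ 2 + b ^+ 2 + d ^+ 2 - t * b = (1 - s) / 2 &
      e ^+ 2 + d ^+ 2 + c ^+ 2 - t * c = (1 - s) / 2] ->
  [/\ a * f + f * b + e * d - t * f = 0,
      a * e + f * d + e * c - t * e = 0 &
      f * e + b * d + d * c - t * d = 0] ->
  [/\ p ^+ 2 + q ^+ 2 + r ^+ 2 = 1,
      [/\ a = t * p ^+ 2, b = t * q ^+ 2 & c = t * r ^+ 2] &
      [/\ d = t * (q * r), e = t * (p * r) & f = t * (p * q)]].
Proof.
move=> t s [a1 a2 a3] [b1 b2 b3] [c1 c2 c3] [d1 d2 d3] [e1 e2 e3].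
have mul z (x y : R) : x = y -> z * x = z * y by move=> ->.
have [Q0|Q_neq0] := eqVneq (p ^+ 2 + q ^+ 2 + r ^+ 2) 0.
  (* Cayley-Hamilton turns the quadratic equation into adj(S / 2) = (1 + s) / 2; its trace gives s =
     -3, so adj(S / 2) = -1. *)
  exfalso; rewrite {}/s Q0 in d1 d2 d3; rewrite {}/t in d1 d2 d3 e1 e2 e3.
  by apply: (@cofactor_sym3_neqN1 _ a b c d e f); lra.
set Q := p ^+ 2 + q ^+ 2 + r ^+ 2 in Q_neq0 *.
(* As S is symmetric with rows parallel to n, Q (S / 2) = t n n^T, here entry by entry. *)
have Qa : Q * a = t * p ^+ 2.
  by move: (mul q _ _ a1) (mul r _ _ a2) (mul p _ _ b1) (mul p _ _ c2);
     rewrite /Q /t; lra.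
have Qb : Q * b = t * q ^+ 2.
  by move: (mul q _ _ a1) (mul r _ _ b3) (mul p _ _ b1) (mul q _ _ c3);
     rewrite /Q /t; lra.
have Qc : Q * c = t * r ^+ 2.
  by move: (mul r _ _ a2) (mul r _ _ b3) (mul p _ _ c2) (mul q _ _ c3);
     rewrite /Q /t; lra.
have Qf : Q * f = t * (p * q).
  by move: (mul p _ _ a1) (mul q _ _ b1) (mul q _ _ c2) (mul r _ _ a3);
     rewrite /Q /t; lra.
have Qe : Q * e = t * (p * r).
  by move: (mul p _ _ a2) (mul r _ _ b1) (mul r _ _ c2) (mul q _ _ a3);
     rewrite /Q /t; lra.
have Qd : Q * d = t * (q * r).
  by move: (mul p _ _ b2) (mul q _ _ b3) (mul r _ _ c3) (mul r _ _ a1);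
     rewrite /Q /t; lra.
have Q2_neq0 : Q ^+ 2 != 0 by rewrite sqrf_eq0.
have minor x y z u v : Q * x = t * u ^+ 2 -> Q * y = t * v ^+ 2 ->
    Q * z = t * (u * v) -> x * y - z ^+ 2 = 0.
  move=> Qx Qy Qz; apply: (mulfI Q2_neq0).
  have -> : Q ^+ 2 * (x * y - z ^+ 2) = (Q * x) * (Q * y) - (Q * z) ^+ 2.
    by ring.
  by rewrite Qx Qy Qz; ring.
(* The vanishing 2-minors leave [s = Q] and make the left side of [d1] zero. *)
have Q1 : Q = 1.
  move: (minor _ _ _ _ _ Qa Qb Qf) (minor _ _ _ _ _ Qa Qc Qe).
  by move: (minor _ _ _ _ _ Qb Qc Qd) d1; rewrite /s /t -/Q; lra.
by move: Qa Qb Qc Qd Qe Qf; rewrite !Q1 !mul1r; split.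
Qed.

Lemma rank_one_add_cross (R : realFieldType) (N : 'M[R]_3) :
  let s := (N 0 0 * N 1 1 - N 0 1 * N 1 0) + (N 0 0 * N 2 2 - N 0 2 * N 2 0)
           + (N 1 1 * N 2 2 - N 1 2 * N 2 1) in
  (N + N^T) *m (N^T - (\tr N)%:M) = (1 - s)%:M ->
  exists p q r, p ^+ 2 + q ^+ 2 + r ^+ 2 = 1 /\
    N = mx_of_rows
      [:: [:: \tr N * p ^+ 2; \tr N * (p * q) + r; \tr N * (p * r) - q];
          [:: \tr N * (p * q) - r; \tr N * q ^+ 2; \tr N * (q * r) + p];
          [:: \tr N * (p * r) + q; \tr N * (q * r) - p; \tr N * r ^+ 2]].
Proof.
move=> s E; pose S := N + N^T; pose K := N - N^T.
(* Since 2 N^T = S - K, the hypothesis makes S K a polynomial in S, hence symmetric and commuting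
   with S. *)
have SKE : S *m K = S *m S - 2 *: (1 - s)%:M - (2 * \tr N) *: S.
  rewrite -E -/S -(mul_mx_scalar (2 * _)) scalemxAr -!mulmxBr; congr (_ *m _).
  by apply/matrixP => i j; rewrite /S /K !mxE; ring.
have SsymE : S^T = S by rewrite /S linearD /= trmxK addrC.
have SK0 : S *m K = 0.
  apply: mul_sym_skew_eq0 => //.
  - by rewrite /K linearB /= trmxK opprB.
  - by rewrite SKE !linearB !linearZ /= trmx_mul SsymE tr_scalar_mx.
  - rewrite SKE !(mulmxBr, mulmxBl) -!scalemxAr -!scalemxAl.
    by rewrite scalar_mxC mulmxA.
have E2 : S *m S = 2 *: (1 - s)%:M + (2 * \tr N) *: S.
  by move/eqP: SKE; rewrite SK0 -addrA -opprD eq_sym subr_eq0 => /eqP.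
have trN : \tr N = N 0 0 + N 1 1 + N 2 2 by rewrite /mxtrace sum_ord3.
have SK i j := congr1 (fun A : 'M_3 => A i j) SK0.
have SS i j := congr1 (fun A : 'M_3 => A i j) E2.
have [] := @sym3_rank_one R (N 0 0) (N 1 1) (N 2 2)
  ((N 1 2 + N 2 1) / 2) ((N 0 2 + N 2 0) / 2) ((N 0 1 + N 1 0) / 2)
  ((N 1 2 - N 2 1) / 2) ((N 2 0 - N 0 2) / 2) ((N 0 1 - N 1 0) / 2).
- move: (SK 0 0) (SK 0 1) (SK 0 2); rewrite !mxE !sum_ord3 !mxE /=.
  by split; lra.
- move: (SK 1 0) (SK 1 1) (SK 1 2); rewrite !mxE !sum_ord3 !mxE /=.
  by split; lra.
- move: (SK 2 0) (SK 2 1) (SK 2 2); rewrite !mxE !sum_ord3 !mxE /=.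
  by split; lra.
- move: (SS 0 0) (SS 1 1) (SS 2 2); rewrite !mxE !sum_ord3 !mxE /= trN /s.
  by split; lra.
- move: (SS 0 1) (SS 0 2) (SS 1 2); rewrite !mxE !sum_ord3 !mxE /= trN.
  by split; lra.
rewrite -trN => Q1 [h1 h2 h3] [h4 h5 h6].
set p := (_ - N 2 1) / 2 in Q1 h1 h2 h3 h4 h5 h6.
set q := (_ - N 0 2) / 2 in Q1 h1 h2 h3 h4 h5 h6.
set r := (_ - N 1 0) / 2 in Q1 h1 h2 h3 h4 h5 h6.
exists p, q, r; split=> //.
apply/matrixP; do 2!apply: ord3_ind;
  rewrite mxE /= -?h1 -?h2 -?h3 -?h4 -?h5 -?h6 /p /q /r; lra.
Qed.

(* With n = (p, q, r), the cross product v of n and (x, y, z) satisfies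
   t v = - n * v; applying n * _ once more gives (1 + t ^ 2) v = 0. *)
Lemma parallel_unit (R : realFieldType) (t p q r x y z : R) :
  p ^+ 2 + q ^+ 2 + r ^+ 2 = 1 ->
  t * (q * z - r * y) = r * (r * x - p * z) - q * (p * y - q * x) ->
  t * (r * x - p * z) = p * (p * y - q * x) - r * (q * z - r * y) ->
  t * (p * y - q * x) = q * (q * z - r * y) - p * (r * x - p * z) ->
  [/\ x = (p * x + q * y + r * z) * p, y = (p * x + q * y + r * z) * q &
      z = (p * x + q * y + r * z) * r].
Proof.
move=> Q1 k0 k1 k2.
have mul c (a b : R) : a = b -> c * a = c * b by move=> ->.
have tt0 : 1 + t ^+ 2 != 0 by rewrite gt_eqF // ltr_wpDr ?sqr_ge0.
set v0 := q * z - r * y in k0 k1 k2; set v1 := r * x - p * z in k0 k1 k2.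
set v2 := p * y - q * x in k0 k1 k2.
have pv : p * v0 + q * v1 + r * v2 = 0 by rewrite /v0 /v1 /v2; ring.
have v00 : v0 = 0.
  apply: (mulfI tt0); move: (mul t _ _ k0) (mul r _ _ k1) (mul q _ _ k2).
  by move: (mul p _ _ pv) (mul v0 _ _ Q1); lra.
have v10 : v1 = 0.
  apply: (mulfI tt0); move: (mul t _ _ k1) (mul p _ _ k2) (mul r _ _ k0).
  by move: (mul q _ _ pv) (mul v1 _ _ Q1); lra.
have v20 : v2 = 0.
  apply: (mulfI tt0); move: (mul t _ _ k2) (mul q _ _ k0) (mul p _ _ k1).
  by move: (mul r _ _ pv) (mul v2 _ _ Q1); lra.
rewrite /v0 in v00; rewrite /v1 in v10; rewrite /v2 in v20.
split.
- by move: (mul x _ _ Q1) (mul q _ _ v20) (mul r _ _ v10); lra.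
- by move: (mul y _ _ Q1) (mul p _ _ v20) (mul r _ _ v00); lra.
- by move: (mul z _ _ Q1) (mul p _ _ v10) (mul q _ _ v00); lra.
Qed.

(** * Coordinates of a torsion-free map *)

Lemma zero_torsion_rows (R : realType) (M : 'M[R]_4) :
  zero_torsion (u2_end M) ->
  exists p q r t u w d, p ^+ 2 + q ^+ 2 + r ^+ 2 = 1 /\
    M = mx_of_rows
      [:: [:: t * p ^+ 2; t * (p * q) + r; t * (p * r) - q; u * p];
          [:: t * (p * q) - r; t * q ^+ 2; t * (q * r) + p; u * q];
          [:: t * (p * r) + q; t * (q * r) - p; t * r ^+ 2; u * r];
          [:: w * p; w * q; w * r; d]].
Proof.
move=> T.
have T_ j k i := congr1 (fun v : u2 R => v i 0)
  (T (u2_basis R j) (u2_basis R k)).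
pose cross (x y : 'I_4 -> R) : seq R :=
  [:: x 1 * y 2 - x 2 * y 1; x 2 * y 0 - x 0 * y 2; x 0 * y 1 - x 1 * y 0; 0].
pose c j l := M l j; pose e j l : R := (l == j :> 'I_4)%:R.
(* With brackets as explicit lists, each instance reduces to a polynomial equation in the entries of
   [M]. *)
have {}T_ j k (i : 'I_4) : (cross (c j) (c k))`_i - (cross (e j) (e k))`_i
    - (\sum_l M i l * (cross (c j) (e k))`_l)
    - (\sum_l M i l * (cross (e j) (c k))`_l) = 0.
  have := T_ j k i; rewrite !u2_endE -!colE !mxE /=.
  by under eq_bigr do rewrite !mxE !andbT;
    under [in X in _ - X]eq_bigr do rewrite !mxE !andbT; rewrite !andbT.
rewrite /cross /c /e in T_ => {cross c e}.
pose N : 'M[R]_3 := mx_of_rows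
  [:: [:: M 0 0; M 0 1; M 0 2]; [:: M 1 0; M 1 1; M 1 2];
      [:: M 2 0; M 2 1; M 2 2]].
have trN : \tr N = M 0 0 + M 1 1 + M 2 2 by rewrite /mxtrace sum_ord3 !mxE.
have [|p [q [r [Q1 NE]]]] := rank_one_add_cross _ N.
  apply/matrixP.
  (* Entry (i, j) is coordinate i of the torsion on the two basis vectors whose bracket is
     [u2_basis R j]. *)
  do 2!apply: ord3_ind;
    [move: (T_ 1 2 0) | move: (T_ 2 0 0) | move: (T_ 0 1 0)
    |move: (T_ 1 2 1) | move: (T_ 2 0 1) | move: (T_ 0 1 1)
    |move: (T_ 1 2 2) | move: (T_ 2 0 2) | move: (T_ 0 1 2)];
    rewrite !sum_ord4 /= !mxE sum_ord3 trN !mxE /=; lra.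
have NE' i j := congr1 (fun A : 'M_3 => A i j) NE.
move: (NE' 0 0) (NE' 0 1) (NE' 0 2) (NE' 1 0) (NE' 1 1) (NE' 1 2).
move: (NE' 2 0) (NE' 2 1) (NE' 2 2).
rewrite !mxE /= {NE NE'}; set t := \tr N in trN *; clearbody t.
move=> m20 m21 m22 m00 m01 m02 m10 m11 m12.
have mE := (m00, m01, m02, m10, m11, m12, m20, m21, m22).
have mul c (a b : R) : a = b -> c * a = c * b by move=> ->.
(* Coordinates of the torsion of (n, J_4). *)
have [] := @parallel_unit R t p q r (M 0 3) (M 1 3) (M 2 3) Q1.
- move: (mul p _ _ (T_ 0 3 0)) (mul q _ _ (T_ 1 3 0)) (mul r _ _ (T_ 2 3 0)).
  rewrite !sum_ord4 /= !mE.
  move: (mul (t * (q * M 2 3 - r * M 1 3)) _ _ Q1); lra.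
- move: (mul p _ _ (T_ 0 3 1)) (mul q _ _ (T_ 1 3 1)) (mul r _ _ (T_ 2 3 1)).
  rewrite !sum_ord4 /= !mE.
  move: (mul (t * (r * M 0 3 - p * M 2 3)) _ _ Q1); lra.
- move: (mul p _ _ (T_ 0 3 2)) (mul q _ _ (T_ 1 3 2)) (mul r _ _ (T_ 2 3 2)).
  rewrite !sum_ord4 /= !mE.
  move: (mul (t * (p * M 1 3 - q * M 0 3)) _ _ Q1); lra.
set u := p * M 0 3 + _ + _ => u0 u1 u2.
(* The last coordinate of the torsion on R^3 gives (t - N) w = 0; take its cross
   product with n. *)
have [] := @parallel_unit R t p q r (M 3 0) (M 3 1) (M 3 2) Q1.
- move: (mul q _ _ (T_ 0 1 3)) (mul r _ _ (T_ 2 0 3)).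
  rewrite !sum_ord4 /= !mE.
  move: (mul (t * (q * M 3 2 - r * M 3 1)) _ _ Q1); lra.
- move: (mul r _ _ (T_ 1 2 3)) (mul p _ _ (T_ 0 1 3)).
  rewrite !sum_ord4 /= !mE.
  move: (mul (t * (r * M 3 0 - p * M 3 2)) _ _ Q1); lra.
- move: (mul p _ _ (T_ 2 0 3)) (mul q _ _ (T_ 1 2 3)).
  rewrite !sum_ord4 /= !mE.
  move: (mul (t * (p * M 3 1 - q * M 3 0)) _ _ Q1); lra.
set w := p * M 3 0 + _ + _ => w0 w1 w2.
exists p, q, r, t, u, w, (M 3 3); split=> //.
by apply/matrixP; do 2!apply: ord4_ind; rewrite mxE.
Qed.

(** * Block matrices, rotations and automorphisms *)

Lemma block_mx31_rows (R : realType) (A : 'M[R]_3) (b : R) :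
  block_mx A 0 0 (b%:M : 'M_1) = mx_of_rows
    [:: [:: A 0 0; A 0 1; A 0 2; 0]; [:: A 1 0; A 1 1; A 1 2; 0];
        [:: A 2 0; A 2 1; A 2 2; 0]; [:: 0; 0; 0; b]] :> 'M_(3 + 1).
Proof.
rewrite -[RHS](@submxK R 3 1 3 1); congr block_mx; apply/matrixP.
- by do 2!apply: ord3_ind; rewrite !mxE.
- by apply: ord3_ind => j; rewrite ord1 !mxE.
- by move=> i; rewrite ord1; apply: ord3_ind; rewrite !mxE.
- by move=> i j; rewrite !ord1 !mxE.
Qed.

Lemma ord2_ind (P : 'I_2 -> Prop) : P 0 -> P 1 -> forall i, P i.
Proof.
by move=> P0 P1 [[|[|//]] lti]; [move: P0 | move: P1]; congr P; apply: val_inj.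
Qed.

Lemma normal_form_rows (R : realType) (xi : 'M[R]_2) :
  u2_normal_form xi = mx_of_rows
    [:: [:: 0; 1; 0; 0]; [:: -1; 0; 0; 0];
        [:: 0; 0; xi 0 0; xi 0 1]; [:: 0; 0; xi 1 0; xi 1 1]].
Proof.
apply: (etrans _ (@submxK R 2 2 2 2 _)); congr block_mx; apply/matrixP;
by do 2!apply: ord2_ind; rewrite !mxE.
Qed.

(** The inverse of [A] is both [A^T] and, as [\det A = 1], the transpose of the cofactor matrix. *)
Lemma SO3_cofactor (R : realType) (A : 'M[R]_3) : SO3 A ->
  A = mx_of_rows
    [:: [:: A 1 1 * A 2 2 - A 1 2 * A 2 1; A 1 2 * A 2 0 - A 1 0 * A 2 2;
            A 1 0 * A 2 1 - A 1 1 * A 2 0];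
        [:: A 2 1 * A 0 2 - A 2 2 * A 0 1; A 2 2 * A 0 0 - A 2 0 * A 0 2;
            A 2 0 * A 0 1 - A 2 1 * A 0 0];
        [:: A 0 1 * A 1 2 - A 0 2 * A 1 1; A 0 2 * A 1 0 - A 0 0 * A 1 2;
            A 0 0 * A 1 1 - A 0 1 * A 1 0]].
Proof.
move=> [/mulmx1C AtA detA]; set C := mx_of_rows _.
have AC : A *m C^T = 1%:M.
  apply/matrixP; rewrite -detA det_mx3; do 2!apply: ord3_ind;
  rewrite !mxE sum_ord3 !mxE /=; ring.
by apply: trmx_inj; rewrite -[RHS]mul1mx -AtA -mulmxA AC mulmx1.
Qed.

(** Being its own cofactor matrix, [A] preserves the cross product. The sign of [b] is free, as
    normalizing a complex structure may need a negative factor on J_4. *)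
Lemma SO3_automorphism (R : realType) (A : 'M[R]_3) (b : R) :
  SO3 A -> b != 0 ->
  lie_automorphism (u2_end (block_mx A 0 0 (b%:M : 'M_1) : 'M_(3 + 1))).
Proof.
move=> SA b0; split.
  have Au : (block_mx A 0 0 (b%:M : 'M_1) : 'M_(3 + 1)) \in unitmx.
    by rewrite unitmxE det_ublock SA.2 mul1r det_scalar1 unitfE.
  exists (u2_end (invmx (block_mx A 0 0 (b%:M : 'M_1) : 'M_(3 + 1)))) => x.
    by rewrite !u2_endE mulKmx.
  by rewrite !u2_endE mulKVmx.
move=> x y; rewrite !u2_endE block_mx31_rows.
have AE i j := congr1 (fun B : 'M_3 => B i j) (SO3_cofactor _ _ SA).
have mul z (u v : R) : u = v -> z * u = z * v by move=> ->.
apply/colP; apply: ord4_ind;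
  [move: (AE 0 0) (AE 0 1) (AE 0 2) | move: (AE 1 0) (AE 1 1) (AE 1 2)
  |move: (AE 2 0) (AE 2 1) (AE 2 2) | by rewrite !mxE sum_ord4 !mxE /=; ring];
  rewrite !mxE !sum_ord4 !mxE /= => h0 h1 h2;
  move: (mul (x 1 0 * y 2 0 - x 2 0 * y 1 0) _ _ h0)
    (mul (x 2 0 * y 0 0 - x 0 0 * y 2 0) _ _ h1)
    (mul (x 0 0 * y 1 0 - x 1 0 * y 0 0) _ _ h2) => {h0 h1 h2 AE}; lra.
Qed.

(* The rotation about e_3 * n taking e_3 to n, unless n = - e_3. *)
Lemma SO3_third_column (R : realType) (p q r : R) :
  p ^+ 2 + q ^+ 2 + r ^+ 2 = 1 ->
  exists A : 'M[R]_3, [/\ SO3 A, A 0 2 = p, A 1 2 = q & A 2 2 = r].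
Proof.
move=> Q1; have [r1|r1] := eqVneq r (-1).
  have /eqP : p ^+ 2 + q ^+ 2 = 0 by move: Q1; rewrite r1; lra.
  rewrite paddr_eq0 ?sqr_ge0 // !sqrf_eq0 => /andP[/eqP -> /eqP ->].
  rewrite r1.
  (* The half-turn about e_1. *)
  exists (mx_of_rows [:: [:: 1; 0; 0]; [:: 0; -1; 0]; [:: 0; 0; -1]]).
  split; rewrite ?mxE //; split.
    apply/matrixP; do 2!apply: ord3_ind; rewrite !mxE sum_ord3 !mxE /=; ring.
  by rewrite det_mx3 !mxE /=; ring.
have r1' : 1 + r != 0 by apply: contra_neq r1; lra.
have pE : p ^+ 2 = 1 - q ^+ 2 - r ^+ 2 by rewrite -Q1; ring.
exists (mx_of_rows [:: [:: 1 - p ^+ 2 / (1 + r); - (p * q / (1 + r)); p];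
  [:: - (p * q / (1 + r)); 1 - q ^+ 2 / (1 + r); q];
  [:: - p; - q; r]]).
split; rewrite ?mxE //; split.
  apply/matrixP; do 2!apply: ord3_ind;
    by rewrite !mxE sum_ord3 !mxE /=; field: pE.
by rewrite det_mx3 !mxE /=; field: pE.
Qed.

(** * Torsion under conjugation and of normal forms *)

(** [Phi] carries the torsion of [J] at (X, Y) to that of [J'] at (Phi X, Phi Y), and [Phi] is
    onto. *)
Lemma zero_torsion_conj (R : realType) (g : lieAlgType R)
    (J J' Phi : 'End(g)) :
  lie_automorphism Phi -> (forall x, J' (Phi x) = Phi (J x)) ->
  zero_torsion J -> zero_torsion J'.
Proof.
move=> [[Psi _ PhiK] PhiM] JPhi TJ X Y.
by rewrite -(PhiK X) -(PhiK Y) !JPhi -!PhiM !JPhi -!linearB TJ linear0.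
Qed.

Lemma mul_normal_form (R : realType) (xi : 'M[R]_2) (x : u2 R) :
  u2_normal_form xi *m x = mx_of_rows
    [:: [:: x 1 0]; [:: - x 0 0]; [:: xi 0 0 * x 2 0 + xi 0 1 * x 3 0];
        [:: xi 1 0 * x 2 0 + xi 1 1 * x 3 0]].
Proof.
rewrite normal_form_rows; apply/colP.
by apply: ord4_ind; rewrite !mxE sum_ord4 !mxE /=; ring.
Qed.

Lemma zero_torsion_normal_form (R : realType) (xi : 'M[R]_2) :
  zero_torsion (u2_end (u2_normal_form xi)).
Proof.
move=> X Y; rewrite !u2_endE !mul_normal_form; apply/colP.
by apply: ord4_ind; rewrite !mxE /=; ring.
Qed.

(** * Equivalence of complex structures *)

(** Trades the conjugation for an intertwining relation free of inverses. *)
Lemma equivalentP (R : realType) (g : lieAlgType R) (J J' : 'End(g)) :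
  equivalent J J' <->
  [/\ complex_structure J, complex_structure J' &
      exists Phi : 'End(g),
        lie_automorphism Phi /\ forall x, J' (Phi x) = Phi (J x)].
Proof.
split=> -[JC J'C [Phi [Phi_aut JE]]]; split=> //; exists Phi; split=> //;
  have /lker0P Phi_inj := bij_inj Phi_aut.1.
  by move=> x; rewrite JE !comp_lfunE lker0_lfunK.
case: Phi_aut => -[Psi _ PhiK] _.
by apply/lfunP => x; rewrite -(PhiK x) JE !comp_lfunE lker0_lfunK.
Qed.

Lemma equivalent_sym (R : realType) (g : lieAlgType R) (J J' : 'End(g)) :
  equivalent J J' -> equivalent J' J.
Proof.
move=> /equivalentP[JC J'C [Phi [[Phi_bij PhiM] JPhi]]].
have Phi_inj := bij_inj Phi_bij; have /lker0P Phi0 := Phi_inj.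
have PhiK : cancel Phi (Phi^-1)%VF := lker0_lfunK Phi0.
have PhiKV : cancel (Phi^-1)%VF Phi by apply/(bij_can_sym Phi_bij).
apply/equivalentP; split=> //; exists (Phi^-1)%VF; split; first split.
- by exists Phi.
- by move=> X Y; apply: Phi_inj; rewrite PhiM !PhiKV.
- by move=> X; apply: Phi_inj; rewrite -JPhi !PhiKV.
Qed.

Lemma equivalent_trans (R : realType) (g : lieAlgType R)
    (J1 J2 J3 : 'End(g)) :
  equivalent J1 J2 -> equivalent J2 J3 -> equivalent J1 J3.
Proof.
move=> /equivalentP[J1C J2C [Phi [[Phi_bij PhiM] JPhi]]].
move=> /equivalentP[_ J3C [Psi [[Psi_bij PsiM] JPsi]]].
apply/equivalentP; split=> //; exists (Psi \o Phi)%VF; split; first split.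
- apply: (eq_bij (bij_comp Psi_bij Phi_bij)) => x; by rewrite comp_lfunE.
- by move=> X Y; rewrite !comp_lfunE PhiM PsiM.
- by move=> X; rewrite !comp_lfunE JPsi JPhi.
Qed.

(** * The structures J(xi) up to equivalence *)

Lemma complex_structure_u2_J (R : realType) (xi : R) :
  complex_structure (u2_J xi).
Proof.
split; last exact: zero_torsion_normal_form.
apply/lfunP => x; rewrite opp_lfunE id_lfunE comp_lfunE !u2_endE.
rewrite !mul_normal_form; apply/colP.
by apply: ord4_ind; rewrite !mxE /=; ring.
Qed.

(* An automorphism preserves the center, spanned by J_4, and the derived
   algebra, spanned by J_1, J_2 and J_3. Modulo the center, the image of J_3 is
   then an eigenvector of J(xi') with the real eigenvalue xi. *)
Lemma equivalent_u2_J_inj (R : realType) (xi xi' : R) :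
  equivalent (u2_J xi) (u2_J xi') -> xi = xi'.
Proof.
move=> /equivalentP[_ _ [Phi [[Phi_bij PhiM] JPhi]]].
pose e := u2_basis R.
have center y : lie (Phi (e 3)) y = 0.
  have [Psi _ PhiK] := Phi_bij.
  by rewrite -(PhiK y) -PhiM u2_lie4 linear0.
have c1 := congr1 (fun v : u2 R => v 2 0) (center (e 0)).
have c2 := congr1 (fun v : u2 R => v 1 0) (center (e 0)).
have c0 := congr1 (fun v : u2 R => v 2 0) (center (e 1)).
rewrite !mxE /= in c0 c1 c2.
have v3 : Phi (e 2) 3 0 = 0 by rewrite /e -u2_lie12 PhiM !mxE.
have Je : u2_J xi (e 2) = xi *: e 2 - (1 + xi ^+ 2) *: e 3.
  rewrite u2_endE mul_normal_form; apply/colP.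
  by apply: ord4_ind; rewrite !mxE /=; ring.
have JPhi2 i := congr1 (fun v : u2 R => v i 0) (JPhi (e 2)).
move: (JPhi2 0) (JPhi2 1) (JPhi2 2); rewrite Je linearB !linearZ /=.
rewrite u2_endE mul_normal_form; set v := Phi (e 2) in v3 *.
set c := Phi (e 3) in c0 c1 c2 *.
rewrite !mxE /= => v0 v1 v2.
have {}c0 : c 0 0 = 0 by lra.
have {}c1 : c 1 0 = 0 by lra.
have {}c2 : c 2 0 = 0 by lra.
rewrite c0 c1 c2 v3 !(oppr0, mulr0, addr0) in v0 v1 v2.
(* If the parameters differ, [v] vanishes: a quarter-turn has no real eigenvalue, which kills the
   first two coordinates, and [(xi' - xi) * v 2 0 = 0]. *)
apply/eqP; apply: contraT => xi_neq.
have v00 : v 0 0 = 0.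
  have xi1 : 1 + xi ^+ 2 != 0 by rewrite gt_eqF // ltr_wpDr ?sqr_ge0.
  by apply: (mulfI xi1); move: v1; rewrite v0; lra.
have v10 : v 1 0 = 0 by rewrite v0 v00 mulr0.
have v20 : v 2 0 = 0.
  have xi_sub : xi' - xi != 0 by rewrite subr_eq0 eq_sym.
  by apply: (mulfI xi_sub); move: v2; lra.
have : e 2 = 0.
  apply: (bij_inj Phi_bij); rewrite linear0; apply/colP.
  by apply: ord4_ind; rewrite !mxE.
by move=> /(congr1 (fun v : u2 R => v 2 0)) /eqP; rewrite !mxE oner_eq0.
Qed.

(** * Reduction to the normal form *)

(** [A] has third column n. The block N multiplies n by t and acts on the plane orthogonal to n as
    the cross product with -n, the quarter-turn of the normal form. *)
Lemma zero_torsion_normalize (R : realType) (M : 'M[R]_4) :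
  zero_torsion (u2_end M) ->
  exists (A : 'M[R]_3) (xi : 'M[R]_2), SO3 A /\
    M *m (block_mx A 0 0 (1%:M : 'M_1) : 'M_(3 + 1)) =
    (block_mx A 0 0 (1%:M : 'M_1) : 'M_(3 + 1)) *m u2_normal_form xi.
Proof.
move=> /zero_torsion_rows[p [q [r [t [u [w [d [Q1 ->]]]]]]]].
have [A [SA A02 A12 A22]] := SO3_third_column _ _ _ _ Q1.
exists A, (mx2 t u w d); split=> //.
have AtA i j := congr1 (fun B : 'M_3 => B i j) (mulmx1C SA.1).
have AE i j := congr1 (fun B : 'M_3 => B i j) (SO3_cofactor _ _ SA).
have mul z (x y : R) : x = y -> z * x = z * y by move=> ->.
have o0 := AtA 2 0; have o1 := AtA 2 1.
rewrite !mxE !sum_ord3 !mxE A02 A12 A22 /= in o0 o1.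
rewrite block_mx31_rows normal_form_rows !mxE /= A02 A12 A22.
(* By columns: the first two of [A] are orthogonal to n ([o0], [o1]) and exchanged up to sign by the
   cross product with n ([AE]); the third uses that n is a unit vector. *)
apply/matrixP => i j; move: j i; apply: ord4_ind.
- move: (AE 0 1) (AE 1 1) (AE 2 1); rewrite !mxE /= A02 A12 A22.
  move: (mul (t * p) _ _ o0) (mul (t * q) _ _ o0) (mul (t * r) _ _ o0).
  move: (mul w _ _ o0) => {AtA AE SA Q1 o0 o1} h1 h2 h3 h4 h5 h6 h7.
  by apply: ord4_ind; rewrite !mxE !sum_ord4 !mxE /=; lra.
- move: (AE 0 0) (AE 1 0) (AE 2 0); rewrite !mxE /= A02 A12 A22.
  move: (mul (t * p) _ _ o1) (mul (t * q) _ _ o1) (mul (t * r) _ _ o1).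
  move: (mul w _ _ o1) => {AtA AE SA Q1 o0 o1} h1 h2 h3 h4 h5 h6 h7.
  by apply: ord4_ind; rewrite !mxE !sum_ord4 !mxE /=; lra.
- move: (mul (t * p) _ _ Q1) (mul (t * q) _ _ Q1) (mul (t * r) _ _ Q1).
  move: (mul w _ _ Q1) => {AtA AE SA Q1 o0 o1} h1 h2 h3 h4.
  by apply: ord4_ind; rewrite !mxE !sum_ord4 !mxE /=; lra.
- by apply: ord4_ind; rewrite !mxE !sum_ord4 !mxE /=; ring.
Qed.

Lemma SO3xRpos_unit (R : realType) (Phi : 'M[R]_4) :
  SO3xRpos Phi -> Phi \in unitmx.
Proof.
move=> [A [b [SA b0 ->]]].
by rewrite unitmxE (@det_ublock R 3 1) SA.2 mul1r det_scalar1 unitfE gt_eqF.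
Qed.

Lemma zero_torsionP (R : realType) (J : 'End(u2 R)) :
  zero_torsion J <->
  exists (Phi : 'M[R]_4) (xi : 'M[R]_2),
    SO3xRpos Phi /\ invmx Phi *m u2_mx J *m Phi = u2_normal_form xi.
Proof.
split=> [|[Phi [xi [SPhi NF]]]].
  rewrite -[J in zero_torsion J]u2_mxK => /zero_torsion_normalize.
  move=> [A [xi [SA AE]]].
  have SPhi : SO3xRpos (block_mx A 0 0 (1%:M : 'M_1) : 'M_(3 + 1)).
    by exists A, 1; split; rewrite ?ltr01.
  exists (block_mx A 0 0 (1%:M : 'M_1) : 'M_(3 + 1)), xi; split=> //.
  by rewrite -mulmxA AE mulKmx // SO3xRpos_unit.
have Phi_unit := SO3xRpos_unit _ _ SPhi.
have [A [b [SA b0 PhiE]]] := SPhi.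
have Phi_aut : lie_automorphism (u2_end Phi).
  by rewrite PhiE; apply: SO3_automorphism; rewrite ?gt_eqF.
apply: (zero_torsion_conj _ _ _ _ _ Phi_aut _ (zero_torsion_normal_form _ xi)).
by move=> x; rewrite -[J]u2_mxK !u2_endE -NF -!mulmxA mulKVmx.
Qed.

(** The lower block (a, b; c, d) of the normal form squares to -1, so bc = -(1 + a^2) is non-zero
    and d = -a; scaling J_4 by [b^-1] turns b into 1. *)
Lemma complex_structure_equivalent (R : realType) (J : 'End(u2 R)) :
  complex_structure J -> exists xi : R, equivalent J (u2_J xi).
Proof.
move=> JC; have [JJ TJ] := JC.
move: TJ; rewrite -[J in zero_torsion J]u2_mxK => /zero_torsion_normalize.
move=> [A [xi [SA AE]]].
set Phi := block_mx A 0 0 _ : 'M_(3 + 1) in AE.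
have NN (x : u2 R) : u2_normal_form xi *m (u2_normal_form xi *m x) = - x.
  have Phi_unit : Phi \in unitmx.
    by rewrite unitmxE (@det_ublock R 3 1) SA.2 det1 mulr1 unitr1.
  apply: (can_inj (mulKmx Phi_unit)).
  have /lfunP/(_ (Phi *m x : u2 R)) := JJ.
  rewrite comp_lfunE opp_lfunE id_lfunE -[J]u2_mxK !u2_endE.
  move=> JJx; rewrite mulmxN -{}JJx.
  by rewrite (mulmxA _ Phi) AE -(mulmxA Phi) (mulmxA _ Phi) AE -!mulmxA.
have n22 := congr1 (fun v : 'cV_4 => v 2 0) (NN (u2_basis R 2)).
have n32 := congr1 (fun v : 'cV_4 => v 3 0) (NN (u2_basis R 2)).
have n23 := congr1 (fun v : 'cV_4 => v 2 0) (NN (u2_basis R 3)).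
rewrite !mul_normal_form !mxE /= !(mulr0, mulr1, addr0, add0r) in n22 n32 n23.
set a := xi 0 0 in n22 n32 n23; set b := xi 0 1 in n22 n32 n23.
set c := xi 1 0 in n22 n32 n23; set d := xi 1 1 in n22 n32 n23.
have b0 : b != 0.
  apply/eqP=> b0; move: n22; rewrite b0 => n22.
  by have := sqr_ge0 a; lra.
have dE : d = - a.
  by apply: (mulfI b0); lra.
have cE : c = - (1 + a ^+ 2) / b.
  by apply: (mulfI b0); rewrite mulrCA divff // mulr1; lra.
exists a; apply: equivalent_sym; apply/equivalentP; split=> //.
  exact: complex_structure_u2_J.
exists (u2_end (block_mx A 0 0 (b^-1%:M : 'M_1) : 'M_(3 + 1))); split.
  by apply: SO3_automorphism; rewrite ?invr_eq0.
move=> x; rewrite -[J]u2_mxK !u2_endE.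
have -> : (block_mx A 0 0 (b^-1%:M : 'M_1) : 'M_(3 + 1)) =
   Phi *m (block_mx 1%:M 0 0 (b^-1%:M : 'M_1) : 'M_(3 + 1)).
  by rewrite /Phi (@mulmx_block R 3 1 3 1 3 1)
       !(mulmx0, mul0mx, mulmx1, mul1mx, addr0, add0r).
rewrite -!mulmxA mulmxA AE -mulmxA; congr (_ *m _).
rewrite block_mx31_rows !mul_normal_form; apply/colP.
apply: ord4_ind; rewrite !mxE !sum_ord4 !mxE /= -/a -/b -/c -/d ?dE ?cE.
- by ring.
- by ring.
- by field.
- by field.
Qed.

Theorem theorem1 (R : realType) :
  (forall J : 'End(u2 R),
     zero_torsion J <->
     exists (Phi : 'M[R]_4) (xi : 'M[R]_2),
       SO3xRpos Phi /\
       invmx Phi *m u2_mx J *m Phi = u2_normal_form xi) /\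
  (forall J : 'End(u2 R), complex_structure J ->
     exists! xi : R, equivalent J (u2_J xi)) /\
  (forall xi xi' : R, equivalent (u2_J xi) (u2_J xi') <-> xi = xi').
Proof.
split; first exact: zero_torsionP.
split=> [J /complex_structure_equivalent[xi JE]|xi xi'].
  exists xi; split=> // xi' JE'; apply: equivalent_u2_J_inj.
  exact: equivalent_trans (equivalent_sym _ _ _ _ JE) JE'.
split=> [|<-]; first exact: equivalent_u2_J_inj.
apply/equivalentP; split; try exact: complex_structure_u2_J.
exists \1%VF; split; first split.
- by exists id => x; rewrite id_lfunE.
- by move=> X Y; rewrite !id_lfunE.
- by move=> x; rewrite !id_lfunE.
Qed.
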